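(* Let $D$ be an integral domain and let $\mathcal{X}$ be a property of integral domains which is stable under the quotient extension. Suppose that every DVR has the property $\mathcal{X}$, and suppose that an integral domain has the property $\mathcal{X}$ if and only if its Nagata ring has the property $\mathcal{X}$. Then the following assertions are equivalent. (1) $D$ is a $t$-locally $\mathcal{X}$-domain. (2) $D[X]$ is a $t$-locally $\mathcal{X}$-domain. (3) $D[X]_A$ is a $t$-locally $\mathcal{X}$-domain. (4) $D[X]_U$ is a $t$-locally $\mathcal{X}$-domain. (5) $D[X]_N$ is a $t$-locally $\mathcal{X}$-domain. (6) $D[X]_{N_v}$ is a $t$-locally $\mathcal{X}$-domain. (7) $D[X]_{N_v}$ is a locally $\mathcal{X}$-domain.
   Context: Properties of integral domains are understood to be invariant under ring isomorphism. For an integral domain $D$ with quotient field $K$ and a nonzero fractional ideal $I$, put $I^{-1}=\{a\in K \mid aI\subseteq D\}$, $I_v=(I^{-1})^{-1}$ and $I_t=\bigcup\{J_v \mid J \text{ a nonzero finitely generated fractional subideal of } I\}$. A prime $t$-ideal is a nonzero prime ideal $P$ with $P_t=P$. $D$ is a locally $\mathcal{X}$-domain (respectively, $t$-locally $\mathcal{X}$-domain) if $D_P$ has the property $\mathcal{X}$ for every prime ideal (respectively, every prime $t$-ideal) $P$ of $D$. $\mathcal{X}$ is stable under the quotient extension if, whenever a domain $D$ has $\mathcal{X}$, so does $D_S$ for every multiplicative subset $S$ of $D$ (not containing $0$). For $f\in D[X]$ (polynomial ring in one indeterminate), $c(f)$ is the ideal of $D$ generated by the coefficients of $f$. Put $A=\{f\in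 D[X]\mid f(0)=1\}$, $U=\{f\in D[X]\mid f\text{ is monic}\}$, $N=\{f\in D[X]\mid c(f)=D\}$, $N_v=\{f\in D[X]\mid f\ne 0,\ c(f)_v=D\}$, which are multiplicative subsets of $D[X]$. $D[X]_N$ is called the Nagata ring of $D$. *)

(* Defs.v *)
From HB Require Import structures.
From mathcomp Require Import all_boot all_order all_algebra.
From mathcomp Require Import zify.
From mathcomp Require Import boolp classical_sets.

Set Implicit Arguments.
Unset Strict Implicit.
Unset Printing Implicit Defensive.

Import GRing.Theory.

Local Open Scope ring_scope.
Local Open Scope classical_set_scope.

Notation "x %:F" := (@FracField.tofrac _ x) : ring_scope.

(* Prime ideals of D are elements of [prime_idealr D]: such an ideal is a
   boolean predicate, proper by definition, and it may be the zero ideal. *)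

Record multSubset (D : idomainType) := MultSubset {
  ms_set : set D;
  ms1 : ms_set 1;
  msM : forall x y, ms_set x -> ms_set y -> ms_set (x * y);
  ms0 : ~ ms_set 0
}.

(* The ring of fractions D_S, as a subring of the quotient field of D. *)
Section Localization.
Variables (D : idomainType) (S : multSubset D).

Definition loc_pred : {pred {fraction D}} :=
  fun x => `[< exists a s, ms_set S s /\ x = a%:F / s%:F >].

Lemma ms_neq0 s : ms_set S s -> s%:F != 0 :> {fraction D}.
Proof. by rewrite tofrac_eq0 => Ss; apply/eqP => s0; apply: (@ms0 D S); rewrite -s0. Qed.

Lemma loc_pred_subring : subring_closed loc_pred.
Proof.
split=> [|x y /asboolP[a [s [Ss ->]]] /asboolP[b [t [St ->]]]
         |x y /asboolP[a [s [Ss ->]]] /asboolP[b [t [St ->]]]]; apply/asboolP.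
- by exists 1, 1; split; [exact: ms1 | rewrite divff ?ms_neq0 //; exact: ms1].
- exists (a * t - b * s), (s * t); split; first exact: msM.
  by rewrite -mulNr addf_div ?ms_neq0 // tofracB !tofracM mulNr.
- exists (a * b), (s * t); split; first exact: msM.
  by rewrite mulf_div !tofracM.
Qed.

HB.instance Definition _ :=
  GRing.isSubringClosed.Build {fraction D} loc_pred loc_pred_subring.

Record loc := Loc { loc_val :> {fraction D}; _ : loc_val \in loc_pred }.

HB.instance Definition _ := [isSub for loc_val].
HB.instance Definition _ := [Choice of loc by <:].
HB.instance Definition _ := [SubChoice_isSubComNzRing of loc by <:].

Definition loc_unit : {pred loc} :=
  fun x => (val x != 0) && ((val x)^-1 \in loc_pred).

Definition loc_inv (x : loc) : loc :=
  if loc_unit x then insubd x (val x)^-1 else x.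

Lemma loc_mulVr : {in loc_unit, left_inverse 1 loc_inv *%R}.
Proof.
move=> x ux; apply: val_inj; rewrite rmorphM rmorph1 /= /loc_inv.
by rewrite ifT //; case/andP: ux => x0 ux; rewrite insubdK // mulVf.
Qed.

Lemma loc_unitPl (x y : loc) : y * x = 1 -> x \in loc_unit.
Proof.
move/(congr1 val); rewrite rmorphM rmorph1 /= => yx1.
have x0 : val x != 0.
  by apply/eqP => x0; move/eqP: yx1; rewrite x0 mulr0 eq_sym oner_eq0.
rewrite unfold_in /loc_unit x0 /=.
suff -> : (val x)^-1 = val y by exact: valP.
by rewrite -[RHS](mulfK x0) yx1 mul1r.
Qed.

Lemma loc_invr_out : {in [predC loc_unit], loc_inv =1 id}.
Proof. by move=> x xn; rewrite /loc_inv ifN. Qed.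

HB.instance Definition _ := GRing.ComNzRing_hasMulInverse.Build loc
  loc_mulVr loc_unitPl loc_invr_out.

Lemma loc_integral : GRing.integral_domain_axiom loc.
Proof.
move=> x y /(congr1 val)/eqP; rewrite rmorphM rmorph0 /= mulf_eq0.
by rewrite -!(inj_eq val_inj) rmorph0.
Qed.

HB.instance Definition _ :=
  GRing.ComUnitRing_isIntegral.Build loc loc_integral.

End Localization.

Section PrimeComplement.
Variables (D : idomainType) (P : prime_idealr D).

Definition prime_compl : set D := [set x | x \notin P].

Lemma prime_compl1 : prime_compl 1.
Proof. by rewrite /prime_compl /= idealr1. Qed.

Lemma prime_complM x y :
  prime_compl x -> prime_compl y -> prime_compl (x * y).
Proof. by rewrite /prime_compl /= prime_idealrM negb_or => -> ->. Qed.

Lemma prime_compl0 : ~ prime_compl 0.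
Proof. by rewrite /prime_compl /= idealr0. Qed.

Definition compl_ms := MultSubset prime_compl1 prime_complM prime_compl0.

End PrimeComplement.

(* D_P *)
Definition loc_at (D : idomainType) (P : prime_idealr D) : idomainType :=
  loc (compl_ms P).

Section FractionalIdeals.
Variable D : idomainType.
Local Notation K := {fraction D}.

Definition fractional_ideal (I : set K) : Prop :=
  [/\ I 0,
      forall (a : D) x y, I x -> I y -> I (a%:F * x + y) &
      exists2 d : D, d != 0 & forall x, I x -> range (@FracField.tofrac D) (d%:F * x)].

Definition nonzero_set (I : set K) : Prop := exists2 x, I x & x != 0.

Definition finitely_generated (I : set K) : Prop :=
  exists s : seq K,
    I = [set x | exists c : nat -> D, x = \sum_(i < size s) (c i)%:F * s`_i].

Definition inv_ideal (I : set K) : set K :=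
  [set a | forall x, I x -> range (@FracField.tofrac D) (a * x)].

Definition v_op (I : set K) : set K := inv_ideal (inv_ideal I).

Definition t_op (I : set K) : set K :=
  [set x | exists J : set K,
     [/\ fractional_ideal J, nonzero_set J, finitely_generated J, J `<=` I &
         v_op J x]].

Definition frac_of (I : set D) : set K := @FracField.tofrac D @` I.

Definition prime_t_ideal (P : prime_idealr D) : Prop :=
  let PK := frac_of [set x | x \in P] in nonzero_set PK /\ t_op PK = PK.

End FractionalIdeals.

Section Content.
Variable D : idomainType.
Implicit Types f g : {poly D}.

Definition content f : set D :=
  [set x | exists c : nat -> D, x = \sum_(i < size f) c i * f`_i].

Definition A_set : set {poly D} := [set f | f.[0] = 1].
Definition U_set : set {poly D} := [set f | f \is monic].
Definition N_set : set {poly D} := [set f | content f = setT].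
Definition Nv_set : set {poly D} :=
  [set f | f != 0 /\ v_op (frac_of (content f)) = frac_of setT].

Lemma A_set1 : A_set 1.
Proof. by rewrite /A_set /= hornerC. Qed.
Lemma A_setM f g : A_set f -> A_set g -> A_set (f * g).
Proof. by rewrite /A_set /= hornerM => -> ->; rewrite mulr1. Qed.
Lemma A_set0 : ~ A_set 0.
Proof. by rewrite /A_set /= horner0 => /eqP; rewrite eq_sym oner_eq0. Qed.

Lemma U_set1 : U_set 1.
Proof. exact: monic1. Qed.
Lemma U_setM f g : U_set f -> U_set g -> U_set (f * g).
Proof. exact: rpredM. Qed.
Lemma U_set0 : ~ U_set 0.
Proof. by rewrite /U_set /= => /monic_neq0; rewrite eqxx. Qed.

Let ideal (I : set D) := I 0 /\ forall a x y, I x -> I y -> I (a * x + y).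
Let regular_mod (I : set D) f := forall d, (forall i, I (d * f`_i)) -> I d.

Let idealM (I : set D) a x : ideal I -> I x -> I (a * x).
Proof. by move=> [I0 IP] Ix; rewrite -[a * x]addr0; exact: IP. Qed.

Let idealD (I : set D) x y : ideal I -> I x -> I y -> I (x + y).
Proof. by move=> [I0 IP] Ix Iy; have := IP 1 x y Ix Iy; rewrite mul1r. Qed.

Let ideal_sum (I : set D) T (r : seq T) (p : pred T) (F : T -> D) : ideal I ->
  (forall i, p i -> I (F i)) -> I (\sum_(i <- r | p i) F i).
Proof.
move=> II IF; elim/big_rec: _ => [|i x pi Ix]; first by case: II.
by apply: idealD => //; exact: IF.
Qed.

Let lead_kill (I : set D) f g n m k : ideal I ->
  (forall i, (n < i)%N -> I f`_i) -> (forall i, I (f * g)`_i) ->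
  (forall j, (m <= j)%N -> I (f`_n ^+ k * g`_j)) ->
  forall j, I (f`_n ^+ (k + m) * g`_j).
Proof.
move=> II If Ifg; elim: m k => [|m IHm] k Ig j; first by rewrite addn0; exact: Ig.
rewrite addnS -addSn; apply: IHm => {}j.
rewrite leq_eqVlt => /predU1P[<-{j}|mj]; last first.
  by rewrite exprS -mulrA; apply: idealM => //; exact: Ig.
have nm : (n < (n + m).+1)%N by rewrite ltnS leq_addr.
have /(idealM (f`_n ^+ k) II) := Ifg (n + m)%N.
rewrite coefM (bigD1 (Ordinal nm)) //= addKn mulrDr mulrA -exprSr => Ix.
set s := \sum_(i < _ | _) _ in Ix.
have Is : I (- f`_n ^+ k * s).
  rewrite mulr_sumr; apply: ideal_sum => // i /eqP ni.
  case: (ltngtP i n) => [lin|lni|ein].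
  - rewrite mulrCA; apply: idealM => //; rewrite mulNr -mulN1r.
    by apply: idealM => //; apply: Ig; lia.
  - by rewrite mulrCA mulrC; apply: idealM => //; exact: If.
  - by case: ni; apply: val_inj.
by have := idealD II Ix Is; rewrite mulNr addrK.
Qed.

Let gauss_mod (I : set D) f g n : ideal I ->
  (forall i, (n <= i)%N -> I f`_i) -> (forall i, I (f * g)`_i) ->
  regular_mod I f -> regular_mod I g -> I 1.
Proof.
elim: n I => [|n IHn] I II If Ifg rf rg.
  by apply: rf => i; rewrite mul1r; exact: If.
have : exists k, I (f`_n ^+ k).
  exists (0 + size g)%N; apply: rg; apply: (@lead_kill I f g n (size g) 0) => // j jg.
  by rewrite (nth_default _ jg) mulr0; case: II.
case; elim=> [|k IHk]; first by rewrite expr0.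
move=> Ik; apply: IHk; pose I' := [set x | I (x * f`_n ^+ k)].
suff : I' 1 by rewrite /I' /= mul1r.
apply: IHn => [|i||d Id|d Id].
- rewrite /I'; split=> [|a x y /= Ix Iy]; first by rewrite /= mul0r; case: II.
  by rewrite mulrDl -mulrA; case: II => _; apply.
- rewrite leq_eqVlt => /predU1P[<-|ni]; first by rewrite /I' /= -exprS.
  by rewrite /I' /= mulrC; apply: idealM => //; exact: If.
- by move=> i; rewrite /I' /= mulrC; exact: idealM.
- by apply: rf => i; rewrite mulrAC; exact: Id.
- by apply: rg => i; rewrite mulrAC; exact: Id.
Qed.

Let content_ideal f : ideal (content f).
Proof.
split=> [|a _ _ [c ->] [c' ->]].
  by exists (fun=> 0); rewrite big1 // => i _; rewrite mul0r.
exists (fun i => a * c i + c' i); rewrite mulr_sumr -big_split /=.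
by apply: eq_bigr => i _; rewrite mulrDl mulrA.
Qed.

Let content_coef f i : content f f`_i.
Proof.
have [fi|fi] := ltnP i (size f); last first.
  by rewrite nth_default //; case: (content_ideal f).
exists (fun j => (j == i)%:R); rewrite (bigD1 (Ordinal fi)) //= eqxx mul1r.
rewrite big1 ?addr0 // => j /eqP ji.
by case: eqP => [e|]; [case: ji; exact: val_inj | rewrite mul0r].
Qed.

Let content_min f (I : set D) :
  ideal I -> (forall i, I f`_i) -> content f `<=` I.
Proof.
by move=> II If _ [c ->]; apply: ideal_sum => // i _; exact: idealM.
Qed.

Let ideal_setT (I : set D) : ideal I -> I 1 -> I = setT.
Proof.
move=> II I1; apply/seteqP; split=> // x _.
by rewrite -[x]mulr1; exact: idealM.
Qed.

Let regular_content (I : set D) f : ideal I -> N_set f -> regular_mod I f.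
Proof.
move=> II Nf d Id; have : content f 1 by rewrite Nf.
move=> /(@content_min f [set x | I (d * x)]); rewrite /= mulr1; apply=> //.
split=> [|a x y /= Ix Iy]; first by rewrite /= mulr0; case: II.
by rewrite mulrDr mulrCA; case: II => _; apply.
Qed.

Lemma N_set1 : N_set 1.
Proof.
apply: ideal_setT => //.
by have := content_coef 1 0; rewrite coef1 eqxx.
Qed.

Lemma N_setM f g : N_set f -> N_set g -> N_set (f * g).
Proof.
move=> Nf Ng; apply: ideal_setT => //.
apply: (@gauss_mod _ f g (size f)) => //; last 2 first.
- exact: regular_content.
- exact: regular_content.
by move=> i fi; rewrite nth_default //; case: (content_ideal (f * g)).
Qed.

Lemma N_set0 : ~ N_set 0.
Proof.
move=> N0; have : content (0 : {poly D}) 1 by rewrite N0.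
by case=> c /eqP; rewrite size_poly0 big_ord0 oner_eq0.
Qed.

Let v_trivial f : v_op (frac_of (content f)) = frac_of setT <->
  inv_ideal (frac_of (content f)) `<=` frac_of setT.
Proof.
split=> [fv x fx|fx].
  have : v_op (frac_of (content f)) 1 by rewrite fv; exists 1 => //; rewrite tofrac1.
  by move=> /(_ x fx); rewrite mul1r.
apply/seteqP; split=> [x vx|_ [x _ <-] y /fx [z _ <-]].
  rewrite -[x]mulr1; apply: vx => _ [y _ <-].
  by rewrite mul1r; exists y.
by exists (x * z) => //; rewrite tofracM.
Qed.

Lemma Nv_set1 : Nv_set 1.
Proof.
split; first exact: oner_neq0.
apply/v_trivial => x /(_ 1); rewrite mulr1; apply.
by rewrite N_set1; exists 1 => //; rewrite tofrac1.
Qed.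

Lemma Nv_setM f g : Nv_set f -> Nv_set g -> Nv_set (f * g).
Proof.
move=> [f0 /v_trivial fv] [g0 /v_trivial gv].
split; first by rewrite mulf_neq0.
apply/v_trivial => x xfg.
pose I : set D := [set d | frac_of setT (x * d%:F)].
have II : ideal I.
  rewrite /I; split=> [|a y z /= [b _ xb] [c _ xc]].
    by exists 0 => //; rewrite tofrac0 mulr0.
  by exists (a * b + c) => //; rewrite !tofracD !tofracM xb xc mulrDr mulrCA.
have rI h : inv_ideal (frac_of (content h)) `<=` frac_of setT -> regular_mod I h.
  move=> hv d Id; apply: hv => _ [y yh <-].
  have : content h `<=` [set y | I (d * y)].
    apply: content_min => //; split=> [|a u v /= Iu Iv].
      by rewrite /= mulr0; case: II.
    by rewrite mulrDr mulrCA; case: II => _; apply.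
  by move=> /(_ y yh); rewrite /I /= tofracM mulrA.
have : I 1.
  apply: (@gauss_mod _ f g (size f)) => //; last 2 first.
  - exact: rI.
  - exact: rI.
  - by move=> i fi; rewrite nth_default //; case: II.
  - move=> i; apply: xfg; exists (f * g)`_i => //; exact: content_coef.
by rewrite /I /= tofrac1 mulr1.
Qed.

Lemma Nv_set0 : ~ Nv_set 0.
Proof. by case; rewrite eqxx. Qed.

Definition A_ms := MultSubset A_set1 A_setM A_set0.
Definition U_ms := MultSubset U_set1 U_setM U_set0.
Definition N_ms := MultSubset N_set1 N_setM N_set0.
Definition Nv_ms := MultSubset Nv_set1 Nv_setM Nv_set0.

End Content.

Definition nagata (D : idomainType) : idomainType := loc (N_ms D).

(* A DVR is a principal ideal domain with exactly one nonzero prime ideal.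
   Elements of [idealr V] are the proper ideals; the unit ideal is principal
   anyway. *)
Definition is_DVR (V : idomainType) : Prop :=
  (forall I : idealr V, exists a, forall x, x \in I <-> exists r, x = r * a) /\
  exists P : prime_idealr V,
    (exists2 x, x \in P & x != 0) /\
    forall Q : prime_idealr V, (exists2 x, x \in Q & x != 0) -> Q =i P.

Section Properties.
Variable X : idomainType -> Prop.

Definition iso_invariant : Prop :=
  forall (D E : idomainType) (phi : {rmorphism D -> E}),
    bijective phi -> X D -> X E.

Definition quotient_stable : Prop :=
  forall (D : idomainType) (S : multSubset D), X D -> X (loc S).

Definition locally (D : idomainType) : Prop :=
  forall P : prime_idealr D, X (loc_at P).

Definition t_locally (D : idomainType) : Prop :=
  forall P : prime_idealr D, prime_t_ideal P -> X (loc_at P).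

End Properties.

(* Main.v *)
From HB Require Import structures.
Require Import Defs.
From mathcomp Require Import all_boot all_order all_algebra.
From mathcomp Require Import ring zify.
From mathcomp Require Import boolp classical_sets.

(** Every ring R among D[X], D[X]_A, D[X]_U, D[X]_N and D[X]_{N_v} is a
    localization of D[X] at a set contained in N_v, and for each of them
    [t_locally X R] is equivalent to [t_locally X D]. Two facts carry the proof.

    The first is a form of McCoy's theorem ([divides_v_set]): if d is a nonzero
    element of D, f is in N_v and d divides f * g, then d divides g. So passing
    from D[X] to R does not create new divisibility by elements of D.

    The second is that, for a prime P of D, the localization of D[X] at P[X] is
    the Nagata ring of D_P ([nagata_localization]), so that X holds for it if and
    only if X holds for D_P.

    Descent to D: for a prime t-ideal P of D, McCoy's theorem shows that P[X]
    extends to a prime t-ideal of R ([extended_t_closed]); its local ring is the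
    Nagata ring of D_P.

    Ascent from D: let Q be the contraction to D[X] of a prime t-ideal of R. If Q
    meets D in zero, the local ring is a DVR or the field of rational functions,
    a localization of a DVR ([property_upper_to_zero]). Otherwise McCoy's theorem
    shows that Q avoids N_v ([t_closed_avoids_v_set]). Then the coefficients of Q
    generate an ideal with proper t-closure, which lies in a prime t-ideal M of D
    by Zorn's lemma ([coefficients_in_prime_t]); thus Q is contained in M[X], and
    the local ring is a localization of the Nagata ring of D_M
    ([property_at_prime]).

    Every prime of D[X]_{N_v} contracts to a prime that avoids N_v, so the same
    argument gives the property at all its primes and not only at its prime
    t-ideals. *)

Set Implicit Arguments.
Unset Strict Implicit.
Unset Printing Implicit Defensive.

Import GRing.Theory.

Local Open Scope ring_scope.
Local Open Scope classical_set_scope.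

(** * Localizations up to isomorphism *)

(** The rings of the theorem lie in several unrelated fraction fields. Describing
    a localization by its map j makes them comparable: D[X], its rings of
    fractions, their local rings and the Nagata rings of the D_P are all
    localizations of D[X], up to an isomorphism that X cannot see. *)
Record is_localization (A R : idomainType) (j : {rmorphism A -> R})
    (S : set A) : Prop := IsLocalization {
  localization_inj : injective j;
  localization_unit : forall s, S s -> j s \is a GRing.unit;
  localization_frac : forall r, exists a s, S s /\ r * j s = j a
}.

(** The universal property: r = j a / j s is sent to k a / k s, which does not
    depend on the chosen fraction because j is injective. *)
Lemma localization_lift (A R B : idomainType) (j : {rmorphism A -> R})
    (S : set A) (k : {rmorphism A -> B}) :
  is_localization j S -> (forall s, S s -> k s \is a GRing.unit) ->
  exists h : {rmorphism R -> B}, forall a, h (j a) = k a.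
Proof.
move=> [jI jU jF] kU.
have /choice[q qP] r : exists q : A * A, S q.2 /\ r * j q.2 = j q.1.
  by have [a [s [Ss e]]] := jF r; exists (a, s).
pose h r := k (q r).1 / k (q r).2.
have hE r a s : k s \is a GRing.unit -> r * j s = j a -> h r = k a / k s.
  move=> Us e; have [/kU Uq eq] := qP r.
  apply: (mulIr Uq); rewrite divrK // mulrAC.
  apply: (mulIr Us); rewrite divrK // -!rmorphM; congr (k _).
  by apply: jI; rewrite !rmorphM -eq -e mulrAC.
have hU r : k (q r).2 \is a GRing.unit by have [/kU] := qP r.
have hK r : h r * k (q r).2 = k (q r).1 by rewrite divrK.
have UM r t : k ((q r).2 * (q t).2) \is a GRing.unit.
  by rewrite rmorphM unitrM !hU.
have h_add : zmod_morphism h.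
  move=> x y; have [_ ex] := qP x; have [_ ey] := qP y.
  apply: (mulIr (UM x y)).
  rewrite (hE _ ((q x).1 * (q y).2 - (q y).1 * (q x).2) _ (UM x y)).
    by rewrite divrK // rmorphB !rmorphM -!hK; ring.
  by rewrite rmorphB !rmorphM -ex -ey; ring.
have h1 a : h (j a) = k a.
  by rewrite (hE _ a 1) rmorph1 ?unitr1 ?mulr1 ?divr1.
have h_mul : monoid_morphism h.
  split=> [|x y]; first by rewrite -(rmorph1 j) h1 rmorph1.
  have [_ ex] := qP x; have [_ ey] := qP y.
  apply: (mulIr (UM x y)).
  rewrite (hE _ ((q x).1 * (q y).1) _ (UM x y)).
    by rewrite divrK // !rmorphM -!hK; ring.
  by rewrite !rmorphM -ex -ey; ring.
pose H : {rmorphism R -> B} :=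
  HB.pack h (GRing.isZmodMorphism.Build R B h h_add)
            (GRing.isMonoidMorphism.Build R B h h_mul).
by exists H.
Qed.

Lemma localization_fix (A R B : idomainType) (j : {rmorphism A -> R})
    (S : set A) (h h' : {rmorphism R -> B}) :
  is_localization j S -> (forall a, h (j a) = h' (j a)) -> h =1 h'.
Proof.
move=> [jI jU jF] hh' r; have [a [s [Ss e]]] := jF r.
have U : h (j s) \is a GRing.unit by rewrite rmorph_unit // jU.
by apply: (mulIr U); rewrite {2}hh' -!rmorphM e hh'.
Qed.

Lemma localization_iso (A R R' : idomainType) (j : {rmorphism A -> R})
    (j' : {rmorphism A -> R'}) (S : set A) :
  is_localization j S -> is_localization j' S ->
  exists h : {rmorphism R -> R'}, bijective h.
Proof.
move=> jL j'L.
have [h hP] := localization_lift jL (localization_unit j'L).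
have [g gP] := localization_lift j'L (localization_unit jL).
exists h; exists g => x.
- apply: (localization_fix (h := g \o h) (h' := idfun) jL) => a /=.
  by rewrite hP gP.
- apply: (localization_fix (h := h \o g) (h' := idfun) j'L) => a /=.
  by rewrite gP hP.
Qed.

Section CanonicalMap.
Variables (A : idomainType) (S : multSubset A).

Lemma tofrac_loc (a : A) : a%:F \in loc_pred S.
Proof. by apply/asboolP; exists a, 1; rewrite tofrac1 divr1; split=> //; apply: ms1. Qed.

Definition loc_map (a : A) : loc S := Loc (tofrac_loc a).

Lemma loc_map_is_zmod_morphism : zmod_morphism loc_map.
Proof. by move=> x y; apply: val_inj; rewrite rmorphB /= tofracB. Qed.

Lemma loc_map_is_monoid_morphism : monoid_morphism loc_map.
Proof.
by split=> [|x y]; apply: val_inj; rewrite ?rmorph1 ?rmorphM /= ?tofrac1 ?tofracM.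
Qed.

HB.instance Definition _ :=
  GRing.isZmodMorphism.Build A (loc S) loc_map loc_map_is_zmod_morphism.
HB.instance Definition _ :=
  GRing.isMonoidMorphism.Build A (loc S) loc_map loc_map_is_monoid_morphism.

Lemma loc_map_localization :
  is_localization (loc_map : {rmorphism A -> loc S}) (ms_set S).
Proof.
split=> [x y /(congr1 val)/eqP|s Ss|r]; first by rewrite /= tofrac_eq => /eqP.
- have si : (s%:F)^-1 \in loc_pred S.
    by apply/asboolP; exists 1, s; rewrite tofrac1 div1r.
  apply/unitrP; exists (Loc si).
  have E : (Loc si : loc S) * loc_map s = 1.
    by apply: val_inj; rewrite rmorphM rmorph1 /= mulVf // (ms_neq0 Ss).
  by split=> //; rewrite mulrC.
- have /asboolP[a [s [Ss e]]] := valP r.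
  exists a, s; split=> //; apply: val_inj.
  by rewrite rmorphM /= [loc_val r]e divfK // (ms_neq0 Ss).
Qed.

End CanonicalMap.

Lemma idfun_localization (A : idomainType) :
  is_localization (idfun : {rmorphism A -> A}) [set 1].
Proof.
split=> [//|s ->|r]; first by rewrite unitr1.
by exists r, 1; rewrite mulr1.
Qed.

Section Property.
Variable X : idomainType -> Prop.
Hypothesis X_iso : iso_invariant X.
Hypothesis X_stable : quotient_stable X.

(** Both hypotheses on X enter here, in the only form in which the proof uses
    them. The larger localization R' is the localization of R at the elements
    that become units in R'; taking this set, instead of the image of S',
    avoids asking S' to be multiplicative. *)
Lemma property_localization (A R R' : idomainType) (j : {rmorphism A -> R})
    (j' : {rmorphism A -> R'}) (S S' : set A) :
  is_localization j S -> is_localization j' S' -> S `<=` S' -> X R -> X R'.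
Proof.
move=> jL j'L SS' XR.
have [h hP] := localization_lift jL (fun s Ss => localization_unit j'L (SS' s Ss)).
(* the multiplicative set at which R' is a localization of R *)
pose T := [set r | r != 0 /\ h r \is a GRing.unit].
have T1 : T 1 by rewrite /T /= oner_neq0 rmorph1 unitr1.
have TM x y : T x -> T y -> T (x * y).
  move=> [x0 hx] [y0 hy].
  by rewrite /T /= mulf_neq0 // rmorphM unitrM hx hy.
have T0 : ~ T 0 by case; rewrite eqxx.
have hL : is_localization h T.
  split=> [x y|r []//|r'].
  - have [a [s [Ss ex]]] := localization_frac jL x.
    have [b [t [St ey]]] := localization_frac jL y => e.
    have jst := localization_unit jL Ss; have jtt := localization_unit jL St.
    apply: (mulIr jst); apply: (mulIr jtt); rewrite ex [y * _ * _]mulrAC ey.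
    rewrite -!rmorphM; congr (j _); apply: (localization_inj j'L).
    by rewrite -!hP !rmorphM -ex -ey !rmorphM e mulrAC.
  - have [a [s [Ss e]]] := localization_frac j'L r'.
    exists (j a), (j s); rewrite !hP; split=> //; split.
      rewrite -(rmorph0 j) (inj_eq (localization_inj jL)).
      apply/eqP=> s0; have := localization_unit j'L Ss.
      by rewrite s0 rmorph0 unitr0.
    by rewrite hP (localization_unit j'L).
pose M := MultSubset T1 TM T0.
have [g g_bij] := localization_iso (loc_map_localization M) hL.
by apply: X_iso g_bij _; apply: X_stable.
Qed.

End Property.

(** * Divisibility and the v-closure *)

Definition divides (A : comNzRingType) (d x : A) := exists r, x = r * d.

Section Divides.
Variable A : comNzRingType.
Implicit Types d x y : A.

Lemma divides0 d : divides d 0.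
Proof. by exists 0; rewrite mul0r. Qed.

Lemma dividesMl d x y : divides d x -> divides d (y * x).
Proof. by move=> [r ->]; exists (y * r); rewrite mulrA. Qed.

Lemma dividesMr d x y : divides d x -> divides d (x * y).
Proof. by rewrite mulrC; exact: dividesMl. Qed.

Lemma dividesD d x y : divides d x -> divides d y -> divides d (x + y).
Proof. by move=> [r ->] [s ->]; exists (r + s); rewrite mulrDl. Qed.

Lemma dividesB d x y : divides d x -> divides d y -> divides d (x - y).
Proof. by move=> [r ->] [s ->]; exists (r - s); rewrite mulrBl. Qed.

Lemma divides_sum d (I : Type) (r : seq I) (P : pred I) (F : I -> A) :
  (forall i, P i -> divides d (F i)) -> divides d (\sum_(i <- r | P i) F i).
Proof. by move=> dF; elim/big_ind: _ => //; [exact: divides0|exact: dividesD]. Qed.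

Lemma divides_polyC d (f : {poly A}) :
  divides d%:P f <-> forall i, divides d f`_i.
Proof.
split=> [[g ->] i|df]; first by rewrite coefMC; exists g`_i.
have /choice[r rP] := df.
exists (\poly_(i < size f) r i); apply/polyP=> i.
rewrite coefMC coef_poly; case: ltnP => [//|fi]; by rewrite nth_default ?mul0r.
Qed.

End Divides.

(** The v-closure of the ideal generated by s, restricted to A: writing an
    element of the quotient field as c / d, it lies in the inverse of the ideal
    exactly when d divides each c * y. Only divisibility in A appears, so that
    this form can be moved along a localization. *)
Definition v_span (A : idomainType) (s : seq A) (x : A) : Prop :=
  forall c d, d != 0 -> (forall y, y \in s -> divides d (c * y)) ->
  divides d (c * x).

Lemma v_span_mem (A : idomainType) (s : seq A) x : x \in s -> v_span s x.
Proof. by move=> xs c d _; apply. Qed.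

Lemma v_span_trans (A : idomainType) (s t : seq A) x :
  (forall y, y \in s -> v_span t y) -> v_span s x -> v_span t x.
Proof. by move=> st sx c d d0 dt; apply: sx => // y /st; apply. Qed.

(** This is N_v; see [Nv_setE]. *)
Definition v_set (A : idomainType) : set {poly A} :=
  [set f : {poly A} | f != 0 /\ v_span f 1].

Lemma v_span_coef (A : idomainType) (f : {poly A}) i : v_span f f`_i.
Proof.
have [fi|fi] := ltnP i (size f); first exact/v_span_mem/mem_nth.
by rewrite nth_default // => c d _ _; rewrite mulr0; exact: divides0.
Qed.

(** McCoy's theorem over A/dA. If the coefficients of f generate an ideal with
    v-closure A, then no element outside dA is multiplied into dA by all of
    them; McCoy's argument then shows that f is regular modulo d. One first
    proves that d divides every product of a coefficient of f and one of g, by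
    induction on the size of g: the multiple of g by a coefficient of f has a
    top coefficient divisible by d, and what remains of it is shorter. *)
Lemma divides_v_set (A : idomainType) (d : A) (f g : {poly A}) :
  d != 0 -> v_set f -> divides d%:P (f * g) -> divides d%:P g.
Proof.
move=> d0 [_ f1]; have [n] := ubnP (size g).
elim: n g => // n IHn g; rewrite ltnS => gn /divides_polyC dfg.
suff dfig i j : divides d (f`_i * g`_j).
  apply/divides_polyC => j; rewrite -[g`_j]mulr1; apply: f1 => // y yf.
  by rewrite mulrC -(nth_index 0 yf).
have [m] := ubnP (size f - i); elim: m i j => // m IHm i j; rewrite ltnS => fim.
(* g has degree at most n - 1, so modulo d the coefficient of index i + n - 1
   of f * g reduces to this product once the products with larger i vanish *)
have top : divides d (f`_i * g`_n.-1).
  have := dfg (i + n.-1)%N; rewrite coefM.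
  have ii : (i < (i + n.-1).+1)%N by lia.
  rewrite (bigD1 (Ordinal ii)) //= addKn => dsum.
  rewrite -[X in divides d X](addrK (\sum_(k < (i + n.-1).+1 | k != Ordinal ii)
     f`_k * g`_(i + n.-1 - k))); apply: dividesB => //.
  apply: divides_sum => -[k kb] /eqP ki /=; case: (ltngtP k i) => [lki|lik|eki].
  - rewrite [X in _ * X]nth_default ?mulr0; first exact: divides0.
    by apply: (leq_trans gn); lia.
  - have [fk|fk] := ltnP k (size f); first by apply: IHm; lia.
    by rewrite [X in X * _]nth_default ?mul0r //; exact: divides0.
  - by case: ki; apply: val_inj.
case: n gn IHn top {IHm fim} => [|n] gn IHn top.
  by rewrite [X in _ * X]nth_default ?mulr0; [exact: divides0|exact: (leq_trans gn)].
pose h := \poly_(k < n) (f`_i * g`_k).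
have gE : (f`_i)%:P * g = h + (f`_i * g`_n)%:P * 'X^n.
  apply/polyP=> k; rewrite coefD !coefCM coef_poly coefXn.
  case: ltngtP => [kn|nk|->]; rewrite ?mulr0 ?addr0 ?add0r ?mulr1 //.
  by rewrite [g`_k]nth_default ?mulr0 //; exact: (leq_trans gn).
have dtop : divides d%:P ((f`_i * g`_n)%:P * 'X^n).
  by apply: dividesMr; case: top => r ->; exists r%:P; rewrite polyCM.
have dh : divides d%:P h.
  apply: IHn; first by rewrite ltnS size_poly.
  have -> : f * h = (f`_i)%:P * (f * g) - f * ((f`_i * g`_n)%:P * 'X^n).
    by rewrite mulrCA gE; ring.
  by apply: dividesB; apply: dividesMl => //; apply/divides_polyC.
have /divides_polyC/(_ j) := dividesD dh dtop.
by rewrite -gE coefCM.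
Qed.

(** * Prime t-ideals and N_v through divisibility *)

Record is_prime_ideal (A : idomainType) (P : set A) : Prop := IsPrimeIdeal {
  prime_ideal0 : P 0;
  prime_idealD : forall x y, P x -> P y -> P (x + y);
  prime_idealMl : forall a x, P x -> P (a * x);
  prime_ideal1 : ~ P 1;
  prime_ideal_prime : forall x y, P (x * y) -> P x \/ P y
}.

Lemma prime_idealr_is_prime (A : idomainType) (P : prime_idealr A) :
  is_prime_ideal [set x | x \in P].
Proof.
split=> [|x y Px Py|a x Px||x y] /=; first exact: idealr0.
- exact: rpredD.
- exact: idealMr.
- by rewrite idealr1.
- by rewrite prime_idealrM => /orP.
Qed.

Lemma is_prime_prime_idealr (A : idomainType) (P : set A) :
  is_prime_ideal P -> exists Q : prime_idealr A, forall x, x \in Q = `[< P x >].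
Proof.
move=> [P0 PD PM P1 PP]; pose S : {pred A} := fun x => `[< P x >].
have SE x : (x \in S) = `[< P x >] by [].
have Sz : zmod_closed S.
  split=> [|x y]; rewrite !SE; first exact/asboolP.
  move=> /asboolP Px /asboolP Py; apply/asboolP; apply: PD => //.
  by rewrite -mulN1r; exact: PM.
have Sp : 1 \notin S /\ forall a, {in S, forall x, a * x \in S}.
  split=> [|a x]; rewrite !SE; first exact/asboolP.
  by move=> /asboolP Px; apply/asboolP; exact: PM.
have Sq : prime_idealr_closed S.
  move=> x y; rewrite !SE => /asboolP /PP[]h; apply/orP; [left|right];
  by rewrite ?SE; apply/asboolP.
pose Q : prime_idealr A := HB.pack (S : A -> bool)
  (GRing.isZmodClosed.Build A S Sz) (isProperIdeal.Build A S Sp)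
  (isPrimeIdealrClosed.Build A S Sq).
by exists Q.
Qed.

Lemma fraction_div (D : idomainType) (x : {fraction D}) :
  exists c d, d != 0 /\ x = c%:F / d%:F.
Proof.
exists (frac (repr x)).1, (frac (repr x)).2.
have d0 := denom_ratioP (repr x); split=> //.
apply: (mulIf (x := (frac (repr x)).2%:F)); first by rewrite tofrac_eq0.
rewrite divfK ?tofrac_eq0 //.
rewrite -{1}[x]reprK; unlock FracField.tofrac.
rewrite -[LHS]FracField.pi_mul; apply/eqmodP; rewrite /= FracField.equivfE.
rewrite /FracField.mulf !numden_Ratio ?oner_neq0 ?mulr1 ?d0 //.
by rewrite mulrC.
Qed.

Lemma range_div (D : idomainType) (c d y : D) : d != 0 ->
  range (@FracField.tofrac D) (c%:F / d%:F * y%:F) <-> divides d (c * y).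
Proof.
move=> d0; have d0F : d%:F != 0 :> {fraction D} by rewrite tofrac_eq0.
split=> [[r _ e]|[r e]].
- exists r; apply/eqP; rewrite -tofrac_eq !tofracM e.
  by rewrite mulrAC divfK.
- by exists r => //; rewrite mulrAC -tofracM e tofracM mulfK.
Qed.

Lemma range_lin (D : idomainType) (s : seq D) (c : nat -> D) (b : {fraction D}) :
  (forall y, y \in s -> range (@FracField.tofrac D) (b * y%:F)) ->
  range (@FracField.tofrac D) (b * \sum_(i < size s) (c i)%:F * (s`_i)%:F).
Proof.
move=> bs; rewrite mulr_sumr; elim/big_ind: _ => [|x y [r _ <-] [t _ <-]|i _].
- by exists 0 => //; rewrite tofrac0.
- by exists (r + t) => //; rewrite tofracD.
- have [r _ e] := bs _ (mem_nth 0 (ltn_ord i)).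
  by exists (c i * r) => //; rewrite tofracM e mulrCA.
Qed.

(** J is the image in the quotient field of the ideal generated by s, in
    whichever way this is written; the two uses are finitely generated
    fractional ideals and contents of polynomials. *)
Lemma v_op_span (D : idomainType) (J : set {fraction D}) (s : seq D) (x : D) :
  (forall y, y \in s -> J y%:F) ->
  (forall z, J z ->
    exists c : nat -> D, z = \sum_(i < size s) (c i)%:F * (s`_i)%:F) ->
  v_op J x%:F <-> v_span s x.
Proof.
move=> sJ Js; split=> [vx c d d0 ds|sx b bJ].
- apply/range_div => //; rewrite mulrC; apply: vx => _ /Js[e ->].
  by apply: range_lin => y ys; apply/range_div => //; exact: ds.
- have [c [d [d0 eb]]] := fraction_div b; rewrite eb mulrC.
  apply/range_div => //; apply: sx => // y ys; apply/range_div => //.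
  by rewrite -eb; apply: bJ; exact: sJ.
Qed.

Definition t_closed (A : idomainType) (P : set A) : Prop :=
  forall (s : seq A) x, (forall y, y \in s -> P y) -> v_span s x -> P x.

Lemma mem_span (D : idomainType) (s : seq D) y : y \in s ->
  exists c : nat -> D, y%:F = \sum_(i < size s) (c i)%:F * (s`_i)%:F.
Proof.
move=> ys; have si : (index y s < size s)%N by rewrite index_mem.
exists (fun j => (j == index y s)%:R); rewrite (bigD1 (Ordinal si)) //= eqxx.
rewrite tofrac1 mul1r nth_index // big1 ?addr0 // => j /eqP ji.
by case: eqP => [e|]; [case: ji; exact: val_inj | rewrite tofrac0 mul0r].
Qed.

(** Adding a nonzero element of P to s does not spoil the inclusion in P, so
    the nonzero finitely generated subideals can be replaced by all finite
    families of elements of P. Conversely, a fractional ideal contained in P is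
    integral, hence so is its v-closure, and generators in the quotient field
    come from D. *)
Lemma prime_t_idealP (D : idomainType) (P : prime_idealr D) :
  prime_t_ideal P <->
  (exists2 a, a \in P & a != 0) /\ t_closed [set x | x \in P].
Proof.
pose K := {fraction D}; pose span (s : seq D) : set K := [set x |
  exists c : nat -> D, x = \sum_(i < size s) (c i)%:F * (s`_i)%:F].
have span_frac s : fractional_ideal (span s).
  split=> [|a _ _ [c ->] [e ->]|].
  - exists (fun=> 0); rewrite big1 // => i _; by rewrite tofrac0 mul0r.
  - exists (fun i => a * c i + e i); rewrite mulr_sumr -big_split /=.
    by apply: eq_bigr => i _; rewrite tofracD tofracM mulrDl mulrA.
  - exists 1; rewrite ?oner_neq0 // => _ [c ->].
    by apply: range_lin => y _; rewrite tofrac1 mul1r; exists y.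
have span_fg s : finitely_generated (span s).
  exists (map (@FracField.tofrac D) s); rewrite /span size_map.
  apply/seteqP; split=> _ [c ->]; exists c; apply: eq_bigr => i _;
  by rewrite (nth_map 0).
have memF x (I : set D) : frac_of I x%:F <-> I x.
  split=> [[y Iy /eqP]|Ix]; last by exists x.
  by rewrite tofrac_eq => /eqP <-.
split=> [[[_ [a Pa <-]] a0 tP]|[[a Pa a0] Pt]].
- rewrite tofrac_eq0 in a0; split; first by exists a.
  move=> s x sP sx; apply/memF; rewrite -tP; exists (span (a :: s)); split=> //.
  + by exists a%:F; rewrite ?tofrac_eq0 //; apply: mem_span; rewrite mem_head.
  + move=> _ [c ->].
    under eq_bigr do rewrite -tofracM.
    rewrite -(big_morph _ (@tofracD D) (tofrac0 D)); apply/memF => /=.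
    apply: rpred_sum => i _; apply: idealMr.
    have := @mem_nth _ 0 (a :: s) _ (ltn_ord i); rewrite inE.
    by case/predU1P => [->//|]; exact: sP.
  + apply/(@v_op_span _ _ (a :: s)) => [y||]; [exact: mem_span|by []|].
    by apply: v_span_trans sx => y ys; apply: v_span_mem; rewrite inE ys orbT.
- split; first by exists a%:F; [apply/memF|rewrite tofrac_eq0].
  apply/seteqP; split=> [x [J [_ [z Jz z0] [s Js] JP vx]]|_ [x Px <-]].
  + have sJ i : (i < size s)%N -> J s`_i.
      move=> si; rewrite Js; exists (fun j => (j == i)%:R).
      rewrite (bigD1 (Ordinal si)) //= eqxx tofrac1 mul1r big1 ?addr0 // => j /eqP ji.
      by case: eqP => [e|]; [case: ji; exact: val_inj | rewrite tofrac0 mul0r].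
    have [y _ xE] : range (@FracField.tofrac D) x.
      rewrite -[x]mulr1; apply: vx => _ /JP[y _ <-].
      by rewrite mul1r; exists y.
    have /choice[u uP] (i : nat) : exists v, (i < size s)%N -> s`_i = v%:F /\ v \in P.
      have [/sJ /JP[v vP <-]|//] := ltnP i (size s); first by exists v.
      by exists 0.
    rewrite -xE; apply/memF; apply: (Pt (mkseq u (size s))) => [v /mapP[i]|].
      by rewrite mem_iota /= => /uP[_ ?] ->.
    apply/(@v_op_span _ J) => [v /mapP[i]||]; last by rewrite xE.
      by rewrite mem_iota add0n /= => si ->; have [<- _] := uP _ si; exact: sJ.
    rewrite Js size_mkseq => w [c ->]; exists c; apply: eq_bigr => i _.
    by rewrite nth_mkseq //; have [-> _] := uP _ (ltn_ord i).
  + exists (span [:: x; a]); split=> //.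
    * by exists a%:F; rewrite ?tofrac_eq0 //; apply: mem_span; rewrite !inE eqxx orbT.
    * move=> _ [c ->]; rewrite !big_ord_recl big_ord0 addr0 /= -!tofracM -tofracD.
      by apply/memF; rewrite /= rpredD ?idealMr.
    * apply/(@v_op_span _ _ [:: x; a]) => [y||]; [exact: mem_span|by []|].
      by apply: v_span_mem; rewrite mem_head.
Qed.

Lemma Nv_setE (D : idomainType) : @Nv_set D = @v_set D.
Proof.
apply/seteqP; suff E (f : {poly D}) :
    v_op (frac_of (content f)) = frac_of setT <-> v_span f 1.
  by split=> f [f0 /E f1].
have <- : v_op (frac_of (content f)) 1%:F <-> v_span f 1.
  apply: v_op_span => [y /(nthP 0)[i fi <-]|z [_ [c ->] <-]].
    exists f`_i => //; exists (fun j => (j == i)%:R).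
    rewrite (bigD1 (Ordinal fi)) //= eqxx mul1r big1 ?addr0 // => j /eqP ji.
    by case: eqP => [e|]; [case: ji; exact: val_inj | rewrite mul0r].
  exists c; rewrite (big_morph _ (@tofracD D) (tofrac0 D)).
  by apply: eq_bigr => i _; rewrite tofracM.
split=> [->|v1]; first by exists 1.
apply/seteqP; split=> [x vx|_ [x _ <-] y yf].
- rewrite -[x]mulr1; apply: vx => _ [y _ <-].
  by rewrite mul1r; exists y.
- have [z _ e] := v1 y yf; rewrite tofrac1 mul1r in e.
  by exists (x * z) => //; rewrite tofracM e.
Qed.

Lemma v_set_coef1 (A : idomainType) (f : {poly A}) i : f`_i = 1 -> v_set f.
Proof.
move=> fi; split; last by rewrite -fi; exact: v_span_coef.
by apply/eqP=> f0; move/eqP: fi; rewrite f0 coef0 eq_sym oner_eq0.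
Qed.

Lemma A_set_v_set (D : idomainType) : @A_set D `<=` @v_set D.
Proof. by move=> f; rewrite /A_set /= horner_coef0 => /v_set_coef1. Qed.

Lemma U_set_v_set (D : idomainType) : @U_set D `<=` @v_set D.
Proof. by move=> f /monicP; exact: v_set_coef1. Qed.

Lemma N_set_v_set (D : idomainType) : @N_set D `<=` @v_set D.
Proof.
move=> f Nf; split.
  by apply/eqP=> f0; apply: (@N_set0 D); rewrite -f0.
have [c ->] : content f 1 by rewrite Nf.
move=> a d d0 df; rewrite mulr_sumr; apply: divides_sum => i _.
by rewrite mulrCA; apply: dividesMl; apply: df; exact: mem_nth.
Qed.

(** * Existence of prime t-ideals *)

Record is_ideal (A : idomainType) (I : set A) : Prop := IsIdeal {
  ideal0 : I 0;
  idealD : forall x y, I x -> I y -> I (x + y);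
  idealMl : forall a x, I x -> I (a * x)
}.

(** For a nonzero ideal I, the t-closure of I is proper. *)
Definition t_proper (A : idomainType) (I : set A) : Prop :=
  forall s : seq A, (forall y, y \in s -> I y) -> ~ v_span s 1.

(** Zorn's lemma applies because t-properness only concerns finite families.
    The empty set is admitted along with the ideals above I, as it is the union
    of the empty chain. *)
Lemma maximal_t_proper (A : idomainType) (I : set A) :
  is_ideal I -> t_proper I ->
  exists M : set A, [/\ is_ideal M, I `<=` M, t_proper M &
    forall N, is_ideal N -> M `<` N -> ~ t_proper N].
Proof.
move=> iI tI; pose good (M : set A) := [/\ is_ideal M, I `<=` M & t_proper M].
have [F FP Ftot|M [MP Mmax]] :=
    @Zorn_bigcup A [set M | M = set0 \/ good M].
- have [[X [FX [x Xx]]]|F0] := pselect (exists X, F X /\ X !=set0); last first.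
    left; apply/seteqP; split=> // x [X FX Xx].
    by apply: F0; exists X; split=> //; exists x.
  have Fgood Y y : F Y -> Y y -> good Y.
    by move=> FY Yy; case: (FP _ FY) => // Y0; rewrite Y0 in Yy.
  have [iX IX tX] := Fgood _ _ FX Xx.
  (* as F is totally ordered, one member contains the whole family *)
  have join (s : seq A) : (forall y, y \in s -> (\bigcup_(X in F) X) y) ->
      exists2 Y, F Y /\ Y !=set0 & forall y, y \in s -> Y y.
    elim: s => [_|y s IHs ys]; first by exists X; [split=> //; exists x|].
    have [|Y [FY [y0 Yy0]] sY] := IHs.
      by move=> z zs; apply: ys; rewrite inE zs orbT.
    have [Z FZ Zy] := ys y (mem_head _ _).
    have [YZ|ZY] := Ftot _ _ FY FZ; [exists Z|exists Y].
    + by split=> //; exists y.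
    + by move=> z; rewrite inE => /predU1P[->//|/sY/YZ].
    + by split=> //; exists y0.
    + by move=> z; rewrite inE => /predU1P[->|/sY//]; exact: ZY.
  right; split.
  + split; first by exists X => //; exact: ideal0.
      move=> y z Uy Uz; have [|Y [FY [w Yw]] sY] := join [:: y; z].
        by move=> w; rewrite !inE => /orP[]/eqP->.
      have [iY _ _] := Fgood _ _ FY Yw.
      exists Y => //; apply: (idealD iY); apply: sY; by rewrite !inE eqxx ?orbT.
    move=> a y [Y FY Yy]; have [iY _ _] := Fgood _ _ FY Yy.
    by exists Y => //; apply: (idealMl iY).
  + by move=> y /IX Xy; exists X.
  + move=> s /join[Y [FY [w Yw]] sY].
    by have [_ _ tY] := Fgood _ _ FY Yw; exact: tY.
- have [iM IM tM] : good M.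
    case: MP => // M0; have /Mmax[] : M `<` I; last by right; split.
    by rewrite M0; split=> // /(_ 0 (ideal0 iI)).
  exists M; split=> // N iN MN tN; apply: (Mmax N) => //; right; split=> //.
  exact: subset_trans IM MN.1.
Qed.

(** An ideal maximal among the t-proper ones is prime and a t-ideal. An element
    x outside M gives a finite family in M + xA whose v-closure contains 1. For
    x, y outside M with xy in M, the products of two such families lie in M and
    their v-closure still contains 1. If x is in the v-closure of a family of M,
    that family together with the M-parts of the one in M + xA has 1 in its
    v-closure. *)
Lemma exists_prime_t_closed (A : idomainType) (I : set A) :
  is_ideal I -> t_proper I ->
  exists M : set A, [/\ is_prime_ideal M, I `<=` M & t_closed M].
Proof.
move=> iI tI; have [M [iM IM tM Mmax]] := maximal_t_proper iI tI.
(* adjoining x to M destroys t-properness *)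
have add x : ~ M x -> exists2 s, v_span s 1 &
    forall y, y \in s -> exists m r, M m /\ y = m + r * x.
  move=> Mx; pose N := [set y | exists m r, M m /\ y = m + r * x].
  have iN : is_ideal N.
    split=> [|_ _ [m [r [Mm ->]]] [n [t [Mn ->]]]|a _ [m [r [Mm ->]]]].
    - by exists 0, 0; rewrite mul0r addr0; split=> //; exact: ideal0.
    - by exists (m + n), (r + t); split; [exact: idealD|ring].
    - by exists (a * m), (a * r); split; [exact: idealMl|ring].
  have MN : M `<` N.
    split=> [y My|NM]; first by exists y, 0; rewrite mul0r addr0.
    by apply/Mx/NM; exists 0, 1; rewrite mul1r add0r; split=> //; exact: ideal0.
  apply: contrapT => nos; apply: (Mmax N iN MN) => s sN s1.
  by apply: nos; exists s.
exists M; split=> //.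
- split=> [|x y|a x||x y Mxy]; [exact: ideal0|exact: idealD|exact: idealMl| |].
    by move=> M1; apply: (tM [:: 1]) => [y|]; [rewrite inE => /eqP->|
      apply: v_span_mem; rewrite mem_head].
  apply: contrapT => /not_orP[/add[s s1 sM] /add[t t1 tyM]].
  apply: (tM [seq a * b | a <- s, b <- t]) => [_ /allpairsP[[a b] /= [aS bT ->]]|].
    have [m [r [Mm ->]]] := sM a aS; have [n [u [Mn ->]]] := tyM b bT.
    have -> : (m + r * x) * (n + u * y) =
      n * m + (u * y * m + (r * x * n + (r * u) * (x * y))) by ring.
    by do !apply: idealD => //; apply: idealMl.
  move=> c d d0 dst; apply: s1 => // a aS.
  rewrite -[c * a]mulr1; apply: t1 => // b bT; rewrite -mulrA; apply: dst.
  exact: allpairs_f.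
- move=> s x sM sx; apply: contrapT => /add[t t1 tM'].
  have /choice[m mP] y : exists m, y \in t -> M m /\ exists r, y = m + r * x.
    have [/tM'[m [r [Mm e]]]|//] := boolP (y \in t); last by exists 0.
    by exists m => _; split=> //; exists r.
  apply: (tM (s ++ map m t)) => [y|].
    by rewrite mem_cat => /orP[/sM//|/mapP[z /mP[Mz _] ->]].
  apply: v_span_trans t1 => y /[dup] yt /mP[_ [r e]] c d d0 dst.
  rewrite e mulrDr; apply: dividesD.
    by apply: dst; rewrite mem_cat map_f ?orbT.
  rewrite mulrCA; apply: dividesMl; apply: sx => // z zs.
  by apply: dst; rewrite mem_cat zs.
Qed.

(** For an ideal P this is P[X]. *)
Definition coef_set (A : idomainType) (P : set A) : set {poly A} :=
  [set f | forall i, P f`_i].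

(** For f and g outside P[X], the product of their first coefficients outside P
    is, modulo P, a coefficient of f * g. *)
Lemma coef_set_prime (A : idomainType) (P : set A) :
  is_prime_ideal P -> is_prime_ideal (coef_set P).
Proof.
move=> [P0 PD PM P1 PP].
have Psum (I : Type) (r : seq I) (Q : pred I) (F : I -> A) :
    (forall i, Q i -> P (F i)) -> P (\sum_(i <- r | Q i) F i).
  by move=> QF; elim/big_ind: _.
split=> [i|f g Pf Pg i|a f Pf i|/(_ 0)|f g Pfg]; first by rewrite coef0.
- by rewrite coefD; exact: PD.
- by rewrite coefM; apply: Psum => k _; exact: PM.
- by rewrite coef1 eqxx.
apply: contrapT => /not_orP[/existsNP[a na] /existsNP[b nb]].
have first_out (h : {poly A}) c : ~ P h`_c ->
    exists m, ~ P h`_m /\ forall k, (k < m)%N -> P h`_k.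
  move=> nc; have ex : exists m, ~~ `[< P h`_m >] by exists c; apply/asboolPn.
  case: (ex_minnP ex) => m /asboolPn nm mmin; exists m; split=> // k km.
  by apply: contrapT => /asboolPn /mmin; rewrite leqNgt km.
have [m [nm Pm]] := first_out _ _ na; have [n [nn Pn]] := first_out _ _ nb.
have mm : (m < (m + n).+1)%N by rewrite ltnS leq_addr.
have := Pfg (m + n)%N; rewrite coefM (bigD1 (Ordinal mm)) //= addKn => Ps.
have : P (f`_m * g`_n).
  rewrite -[f`_m * g`_n](addrK (\sum_(i < (m + n).+1 | i != Ordinal mm)
    f`_i * g`_(m + n - i))) -mulN1r; apply: PD => //; apply: (PM).
  apply: Psum => -[k kb] /eqP km /=; case: (ltngtP k m) => [lkm|lmk|ekm].
  - by rewrite mulrC; apply: (PM); exact: Pm.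
  - by apply: (PM); apply: Pn; lia.
  - by case: km; apply: val_inj.
by case/PP.
Qed.

(** * Prime ideals in localizations *)

Lemma loc_at_localization (A : idomainType) (P : set A) :
  is_prime_ideal P -> exists (R : idomainType) (j : {rmorphism A -> R}),
    is_localization j (~` P).
Proof.
move=> /is_prime_prime_idealr[Q QP].
exists (loc_at Q), (loc_map (compl_ms Q)).
have <- : ms_set (compl_ms Q) = ~` P; last exact: loc_map_localization.
by apply/seteqP; split=> x /=; rewrite /prime_compl /= QP => /asboolPn.
Qed.

Lemma loc_map_prime (A : idomainType) (P : prime_idealr A) :
  is_localization (loc_map (compl_ms P) : {rmorphism A -> loc_at P})
    (~` [set x | x \in P]).
Proof.
have <- : ms_set (compl_ms P) = ~` [set x | x \in P].
  by apply/seteqP; split=> x /= /negP.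
exact: loc_map_localization.
Qed.

Lemma unit_notin_prime (A : idomainType) (P : set A) x :
  is_prime_ideal P -> x \is a GRing.unit -> ~ P x.
Proof.
move=> PP xU Px; apply: (prime_ideal1 PP).
by rewrite -(mulVr xU); exact: prime_idealMl.
Qed.

Lemma prime_ideal_contract (A R : idomainType) (j : {rmorphism A -> R})
    (P : set R) : is_prime_ideal P -> is_prime_ideal (j @^-1` P).
Proof.
move=> [P0 PD PM P1 PP]; split=> [|x y|a x||x y] /=.
- by rewrite rmorph0.
- by rewrite rmorphD; exact: PD.
- by rewrite rmorphM; exact: PM.
- by rewrite rmorph1.
- by rewrite rmorphM; exact: PP.
Qed.

(** The extension consists of the r all of whose numerators lie in P; as S
    avoids P, one numerator in P suffices. Quantifying over all numerators
    keeps the argument independent of S being multiplicative. *)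
Lemma prime_ideal_extend (A R : idomainType) (j : {rmorphism A -> R})
    (S P : set A) :
  is_localization j S -> is_prime_ideal P -> S `<=` ~` P ->
  exists2 P' : set R, is_prime_ideal P' & j @^-1` P' = P.
Proof.
move=> [jI _ jF] PP SP; have [P0 PD PM P1 PX] := PP.
have PMr a x : P x -> P (x * a) by rewrite mulrC; exact: PM.
have drop a s : S s -> P (a * s) -> P a by move=> /SP Ps /PX[].
have same r a b s t : S s -> S t -> r * j s = j a -> r * j t = j b ->
    P a -> P b.
  move=> Ss St ea eb Pa; apply: (drop _ s) => //.
  have -> : b * s = a * t by apply: jI; rewrite !rmorphM -ea -eb; ring.
  exact: PMr.
pose P' := [set r | forall a s, S s -> r * j s = j a -> P a].
have P'P r a s : S s -> r * j s = j a -> P' r <-> P a.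
  move=> Ss e; split=> [P'r|Pa b t St eb]; first exact: P'r e.
  exact: same Ss St e eb Pa.
exists P'; last first.
  apply/seteqP; split=> a /=.
    have [b [s [Ss e]]] := jF (j a) => /(_ _ _ Ss e).
    have <- : a * s = b by apply: jI; rewrite rmorphM.
    exact: drop.
  move=> Pa b s Ss; rewrite -rmorphM => /jI <-; exact: PMr.
split=> [a s _|x y P'x P'y a s Ss ea|r x P'x a s Ss ea|P'1|x y P'xy].
- by rewrite mul0r -(rmorph0 j) => /jI <-.
- have [b [t [St eb]]] := jF x; have [c [u [Su ec]]] := jF y.
  have Pb : P b by exact: P'x eb.
  have Pc : P c by exact: P'y ec.
  apply: (drop _ t) => //; apply: (drop _ u) => //.
  have -> : a * t * u = (u * s) * b + (t * s) * c.
    by apply: jI; rewrite rmorphD !rmorphM -ea -eb -ec; ring.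
  by apply: (PD); apply: (PM).
- have [b [t [St eb]]] := jF x; have [c [u [Su ec]]] := jF r.
  have Pb : P b by exact: P'x eb.
  apply: (drop _ t) => //; apply: (drop _ u) => //.
  have -> : a * t * u = (c * s) * b.
    by apply: jI; rewrite !rmorphM -ea -eb -ec; ring.
  exact: (PM).
- have [b [t [St eb]]] := jF 1; apply: (SP _ St).
  by apply: P'1 St _; rewrite mul1r.
- have [b [t [St eb]]] := jF x; have [c [u [Su ec]]] := jF y.
  have [a [s [Ss ea]]] := jF (x * y).
  have : P (b * c).
    apply: (drop _ s) => //; have -> : b * c * s = a * (t * u).
      by apply: jI; rewrite !rmorphM -ea -eb -ec; ring.
    exact: PMr (P'xy _ _ Ss ea).
  by case/PX => [/(P'P _ _ _ St eb)|/(P'P _ _ _ Su ec)]; [left|right].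
Qed.

(** R localized at P is A localized at the contraction of P. *)
Lemma localization_comp (A R B : idomainType) (j : {rmorphism A -> R})
    (k : {rmorphism R -> B}) (S : set A) (P : set R) :
  is_localization j S -> is_prime_ideal P -> is_localization k (~` P) ->
  is_localization (k \o j : {rmorphism A -> B}) (~` (j @^-1` P)).
Proof.
move=> jL PP kL; split=> [|s /(localization_unit kL) //|b].
  exact: inj_comp (localization_inj kL) (localization_inj jL).
have [r [r' [Pr' e]]] := localization_frac kL b.
have [a [s [Ss ea]]] := localization_frac jL r.
have [a' [s' [Ss' ea']]] := localization_frac jL r'.
exists (a * s'), (a' * s); split=> /=.
  rewrite rmorphM -ea'.
  have nP t : S t -> ~ P (j t).
    by move=> /(localization_unit jL)/(unit_notin_prime PP).
  by case/(prime_ideal_prime PP) => [/(prime_ideal_prime PP)[]|]; last exact: nP;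
    rewrite ?Pr' //; exact: nP.
by rewrite !rmorphM -ea -ea' !rmorphM -e; ring.
Qed.

(** * The Nagata ring of D_P *)

Lemma clear_denominators (A R : idomainType) (i : {rmorphism A -> R})
    (P : set A) (F : {poly R}) :
  is_prime_ideal P -> is_localization i (~` P) ->
  exists f t, ~ P t /\ map_poly i f = (i t)%:P * F.
Proof.
move=> PP iL; elim/poly_ind: F => [|F c [f [t [Pt e]]]].
  by exists 0, 1; rewrite rmorph0 mulr0; split=> //; exact: prime_ideal1.
have [a [s [Ps ec]]] := localization_frac iL c.
exists (s%:P * f * 'X + (t * a)%:P), (t * s); split.
  by case/(prime_ideal_prime PP).
rewrite rmorphD !rmorphM /= map_polyX !map_polyC /= e -ec.
by rewrite !polyCM; ring.
Qed.

(** Stated over abstract rings so that no computation takes place in the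
    concrete ring of fractions of the next lemma. *)
Lemma fraction_scale (A B : comNzRingType) (k : {rmorphism A -> B}) r
    (F G F' G' u t : A) :
  r * k G = k F -> G' = t * (u * G) -> F' = u * (t * F) -> r * k G' = k F'.
Proof. by move=> e -> ->; rewrite !rmorphM -e; ring. Qed.

(** The Nagata ring of D_P is D[X] localized at P[X]. A polynomial over D with
    a coefficient outside P has unit content over D_P. Conversely, if G over D_P
    has unit content and u * G = g has coefficients in D, with u outside P, then
    g is outside P[X]: otherwise u would be in the maximal ideal of D_P. *)
Lemma nagata_localization (D : idomainType) (P : prime_idealr D) :
  exists j : {rmorphism {poly D} -> nagata (loc_at P)},
    is_localization j (~` coef_set [set x | x \in P]).
Proof.
set V := loc_at P; pose i : {rmorphism D -> V} := loc_map (compl_ms P).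
have iL : is_localization i (~` [set x | x \in P]) by exact: loc_map_prime.
pose k : {rmorphism {poly V} -> nagata V} := loc_map (N_ms V).
have kL : is_localization k (@N_set V) by exact: loc_map_localization.
have PP := prime_idealr_is_prime P.
exists (k \o map_poly i : {rmorphism _ -> _}); split=> [|f /existsNP[n fn]|r].
- apply: inj_comp (localization_inj kL) _.
  by apply: map_inj_poly; [exact: localization_inj iL|exact: rmorph0].
- apply: (localization_unit kL); apply/seteqP; split=> // x _.
  have U := localization_unit iL fn.
  have nf : (n < size (map_poly i f))%N.
    rewrite ltnNge; apply/negP => /(nth_default 0) e.
    by move: U; rewrite -coef_map e unitr0.
  exists (fun m => if m == n then x / i f`_n else 0).
  rewrite (bigD1 (Ordinal nf)) //= eqxx coef_map /= divrK // big1 ?addr0 //.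
  move=> m /eqP mn; case: eqP => [e|_]; last by rewrite mul0r.
  by case: mn; apply: val_inj.
- have [F [G [NG e]]] := localization_frac kL r.
  have [f [t [Pt ef]]] := clear_denominators F PP iL.
  have [g [u [Pu eg]]] := clear_denominators G PP iL.
  exists (u%:P * f), (t%:P * g); split.
    move=> /(prime_ideal_prime (coef_set_prime PP))[/(_ 0)|Pg].
      by rewrite coefC.
    have [P' PP' P'P] := prime_ideal_extend iL PP (@subset_refl _ _).
    have P'i a : P' (i a) <-> a \in P.
      by have := congr1 (fun Z : set D => Z a) P'P => /= ->.
    apply: Pu; apply/P'i.
    have [c e1] : content G 1 by rewrite NG.
    rewrite -[i u]mulr1 e1 mulr_sumr.
    elim/big_ind: _ => [||m _]; [exact: prime_ideal0|exact: prime_idealD|].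
    rewrite mulrCA; apply: (prime_idealMl PP').
    by rewrite -coefCM -eg coef_map; apply/P'i; exact: Pg.
  have cM c h : map_poly i (c%:P * h) = (i c)%:P * map_poly i h.
    by rewrite rmorphM /= map_polyC.
  have eF : map_poly i (u%:P * f) = (i u)%:P * ((i t)%:P * F) by rewrite cM ef.
  have eG : map_poly i (t%:P * g) = (i t)%:P * ((i u)%:P * G) by rewrite cM eg.
  exact: fraction_scale e eG eF.
Qed.

(** * Primes of D[X] lying over zero *)

(** A nonzero prime Q of D[X] that meets D in zero has a discrete valuation
    localization. Nonzero constants are units there, so division with remainder
    by a polynomial f of least degree in Q can be carried out up to units; hence
    every nonzero element is a unit times a power of f. *)
Section UpperToZero.
Variables (D : idomainType) (Q : set {poly D}).
Hypothesis QP : is_prime_ideal Q.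
Hypothesis QD : forall a, Q a%:P -> a = 0.
Variables (R : idomainType) (k : {rmorphism {poly D} -> R}).
Hypothesis kL : is_localization k (~` Q).

Lemma unit_outside g : ~ Q g -> k g \is a GRing.unit.
Proof. exact: localization_unit kL g. Qed.

Lemma minimal_generator : (exists2 f, Q f & f != 0) ->
  exists f, [/\ Q f, f != 0 & forall g, Q g -> g != 0 -> (size f <= size g)%N].
Proof.
move=> [f0 Qf0 f00].
have ex : exists n, `[< exists f, [/\ Q f, f != 0 & size f = n] >].
  by exists (size f0); apply/asboolP; exists f0.
case: (ex_minnP ex) => n /asboolP[f [Qf fn0 <-]] nmin.
by exists f; split=> // g Qg g0; apply: nmin; apply/asboolP; exists g.
Qed.

Variable f : {poly D}.
Hypotheses (Qf : Q f) (f0 : f != 0).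
Hypothesis f_min : forall g, Q g -> g != 0 -> (size f <= size g)%N.

(** Pseudo-division: some c * g is q * f + r with r shorter than f and c a
    nonzero constant. If g is in Q, then r is in Q, so r = 0 by minimality, and
    the induction continues with q. *)
Lemma power_decomposition_poly g : g != 0 ->
  exists n u, u \is a GRing.unit /\ k g = u * k f ^+ n.
Proof.
have [m] := ubnP (size g); elim: m g => // m IHm g; rewrite ltnS => gm g0.
have [Qg|nQg] := pselect (Q g); last first.
  by exists 0, (k g); rewrite expr0 mulr1; split=> //; exact: unit_outside.
have e := Pdiv.WeakIdomain.divp_eq g f.
set c := lead_coef f ^+ scalp g f in e; set q := g %/ f in e.
have c0 : c != 0 by rewrite expf_neq0 // lead_coef_eq0.
have r0 : g %% f = 0.
  apply: contrapT => /eqP rn0; have := f_min _ rn0.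
  rewrite leqNgt ltn_modp f0 => /(_ _)/negP; apply => //.
  have -> : g %% f = c%:P * g + - q * f by rewrite mul_polyC e; ring.
  by apply: (prime_idealD QP); apply: (prime_idealMl QP).
rewrite r0 addr0 in e.
have q0 : q != 0.
  apply: contra_neq g0 => q0; move: e; rewrite q0 mul0r => /eqP.
  by rewrite scale_poly_eq0 (negPf c0) => /eqP.
have f1 : (1 < size f)%N.
  rewrite ltnNge; apply/negP => /size1_polyC fE; move: Qf f0.
  by rewrite fE => /QD ->; rewrite eqxx.
have qm : (size q < m)%N.
  apply: leq_trans gm; rewrite -(size_scale g c0) e size_mul //.
  by case: (size f) f1 => [|[|n]] //= _; rewrite addnS /= addnS ltnS leq_addr.
have [n [u [uU qE]]] := IHm _ qm q0.
have cU : k c%:P \is a GRing.unit.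
  by apply: unit_outside => /QD /eqP; rewrite (negPf c0).
exists n.+1, ((k c%:P)^-1 * u); split; first by rewrite unitrM unitrV cU.
apply: (mulrI cU); rewrite exprSr !mulrA mulrV // mul1r -qE -!rmorphM.
by rewrite mul_polyC e.
Qed.

Lemma power_decomposition r : r != 0 ->
  exists n u, u \is a GRing.unit /\ r = u * k f ^+ n.
Proof.
move=> r0; have [a [s [Ss e]]] := localization_frac kL r.
have sU := unit_outside Ss.
have a0 : a != 0.
  apply: contra_neq r0 => a0; apply: (mulIr sU).
  by rewrite e a0 rmorph0 mul0r.
have [n [u [uU ae]]] := power_decomposition_poly a0.
exists n, ((k s)^-1 * u); split; first by rewrite unitrM unitrV sU.
by apply: (mulrI sU); rewrite !mulrA mulrV // mul1r -ae mulrC.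
Qed.

Lemma prime_ideal_power (P : set R) n u : is_prime_ideal P ->
  u \is a GRing.unit -> P (k f) -> P (u * k f ^+ n) <-> (0 < n)%N.
Proof.
move=> PP uU Pf; case: n => [|n].
  by rewrite expr0 mulr1; split=> // /(unit_notin_prime PP uU).
by split=> // _; rewrite exprSr mulrA; exact: prime_idealMl.
Qed.

Lemma prime_ideal_uniformizer (P : set R) : is_prime_ideal P ->
  (exists2 x, P x & x != 0) -> P (k f).
Proof.
move=> PP [x Px /power_decomposition[n [u [uU e]]]]; move: Px; rewrite e.
move=> /(prime_ideal_prime PP)[/(unit_notin_prime PP uU)//|].
elim: n {e} => [|n IHn]; first by rewrite expr0 => /(prime_ideal1 PP).
by rewrite exprS => /(prime_ideal_prime PP)[].
Qed.

Lemma uniformizer_DVR : is_DVR R.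
Proof.
split=> [I|].
  have [[y [Iy y0]]|I0] := pselect (exists x, x \in I /\ x != 0); last first.
    exists 0 => x; split=> [Ix|[r ->]]; last by rewrite mulr0 idealr0.
    exists 0; rewrite mulr0; apply: contrapT => /eqP x0.
    by apply: I0; exists x.
  have powI n u : u \is a GRing.unit -> u * k f ^+ n \in I -> k f ^+ n \in I.
    by move=> uU /(idealMr u^-1); rewrite mulrA mulVr // mul1r.
  have ex : exists n, k f ^+ n \in I.
    have [n [u [uU e]]] := power_decomposition y0.
    by exists n; apply: (powI _ u uU); rewrite -e.
  case: (ex_minnP ex) => n In nmin; exists (k f ^+ n) => x.
  split=> [Ix|[r ->]]; last exact: idealMr.
  have [->|x0] := eqVneq x 0; first by exists 0; rewrite mul0r.
  have [m [u [uU e]]] := power_decomposition x0.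
  have nm : (n <= m)%N by apply: nmin; apply: (powI _ u uU); rewrite -e.
  by exists (u * k f ^+ (m - n)); rewrite -mulrA -exprD subnK.
have [P' PP' P'Q] := prime_ideal_extend kL QP (@subset_refl _ _).
have P'f : P' (k f) by have := Qf; rewrite -P'Q.
have kf0 : k f != 0.
  by rewrite -(rmorph0 k) (inj_eq (localization_inj kL)).
have [P PE] := is_prime_prime_idealr PP'.
exists P; split; first by exists (k f) => //; rewrite PE; apply/asboolP.
move=> Q2 [x Q2x x0] y; rewrite PE.
have PQ2 := prime_idealr_is_prime Q2.
have Q2f : Q2 (k f) by apply: (prime_ideal_uniformizer PQ2); exists x.
have [->|y0] := eqVneq y 0.
  by rewrite idealr0; apply/esym/asboolP; exact: prime_ideal0.
have [n [u [uU ->]]] := power_decomposition y0.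
apply/idP/asboolP.
- by move/(prime_ideal_power n PQ2 uU Q2f)/(prime_ideal_power n PP' uU P'f).
- by move/(prime_ideal_power n PP' uU P'f)/(prime_ideal_power n PQ2 uU Q2f).
Qed.

End UpperToZero.

Lemma upper_to_zero_DVR (D R : idomainType) (Q : set {poly D})
    (k : {rmorphism {poly D} -> R}) :
  is_prime_ideal Q -> (forall a, Q a%:P -> a = 0) ->
  (exists2 f, Q f & f != 0) -> is_localization k (~` Q) -> is_DVR R.
Proof.
move=> QP QD /(minimal_generator (Q := Q))[f [Qf f0 fmin]] kL.
exact: uniformizer_DVR QP QD _ _ kL f Qf f0 fmin.
Qed.

Lemma coef0_prime (D : idomainType) :
  is_prime_ideal [set f : {poly D} | f`_0 = 0].
Proof.
split=> [|f g /= f0 g0|f g /= g0||f g /=]; rewrite /= ?coef0 //.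
- by rewrite coefD f0 g0 addr0.
- by rewrite coef0M g0 mulr0.
- by rewrite coef1 /=; apply/eqP; exact: oner_neq0.
- by rewrite coef0M => /eqP; rewrite mulf_eq0 => /orP[]/eqP; [left|right].
Qed.

(** If Q = 0, then R is the field of rational functions over D; it is a
    localization of the valuation ring at (X), so X holds by stability. *)
Lemma property_upper_to_zero (X : idomainType -> Prop) (D R : idomainType)
    (Q : set {poly D}) (k : {rmorphism {poly D} -> R}) :
  iso_invariant X -> quotient_stable X ->
  (forall V : idomainType, is_DVR V -> X V) ->
  is_prime_ideal Q -> (forall a, Q a%:P -> a = 0) ->
  is_localization k (~` Q) -> X R.
Proof.
move=> X_iso X_stable X_DVR QP QD kL.
have [Q0|Q0] := pselect (exists2 f, Q f & f != 0).
  exact/X_DVR/(upper_to_zero_DVR QP QD Q0 kL).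
have TP := coef0_prime D.
have [V [j jL]] := loc_at_localization TP.
apply: (property_localization X_iso X_stable jL kL).
  move=> f; apply: contra_not => Qf /=; apply: contrapT => f0; apply: Q0.
  by exists f => //; apply/eqP => fz; apply: f0; rewrite fz coef0.
apply: X_DVR; apply: (upper_to_zero_DVR TP _ _ jL) => [a|].
  by rewrite /= coefC.
by exists 'X; rewrite /= ?coefX ?polyX_eq0.
Qed.

(** * Prime t-ideals of the localizations of D[X] *)

(** For a t-closed P, the extension of P[X] to R is again t-closed.
    After clearing denominators a finite family of the extension consists of
    polynomials over P, and their coefficients form a finite family J in P. Let
    g be a numerator of an element in the v-closure of the family. A fraction
    c / d of D that multiplies J into D multiplies the polynomials into D[X],
    hence multiplies g into R; as the denominators of R are in N_v, McCoy's
    theorem brings c * g / d back to D[X]. So the coefficients of g lie in the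
    v-closure of J, hence in P. *)
Lemma extended_t_closed (D R : idomainType) (j : {rmorphism {poly D} -> R})
    (S : set {poly D}) (P : set D) (P' : set R) :
  is_localization j S -> S `<=` @v_set D -> t_closed P ->
  is_prime_ideal P' -> j @^-1` P' = coef_set P -> t_closed P'.
Proof.
move=> jL Sv tP PP' P'P s u sP' su.
have P'j f : P' (j f) <-> coef_set P f.
  by rewrite -P'P.
have /choice[q qP] r : exists p : {poly D} * {poly D},
    S p.2 /\ r * j p.2 = j p.1.
  by have [a [t [St e]]] := localization_frac jL r; exists (a, t).
have [g [w [Sw eg]]] := localization_frac jL u.
suff /P'j : coef_set P g.
  rewrite -eg => /(prime_ideal_prime PP')[//|].
  by move=> /(unit_notin_prime PP' (localization_unit jL Sw)).
move=> i; apply: (tP (flatten [seq polyseq (q y).1 | y <- s])) => [z|].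
  move=> /flatten_mapP[y ys /(nthP 0)[n _ <-]].
  have [_ ey] := qP y; have /P'j : P' (j (q y).1); last exact.
  by rewrite -ey mulrC; apply: (prime_idealMl PP'); exact: sP'.
move=> c d d0 dJ; suff : divides d%:P (c%:P * g).
  by move=> /divides_polyC/(_ i); rewrite coefCM.
have dj0 : j d%:P != 0.
  by rewrite -(rmorph0 j) (inj_eq (localization_inj jL)) polyC_eq0.
have [r er] : divides (j d%:P) (j c%:P * u).
  apply: su => // y ys; have [Sy ey] := qP y.
  have tU := localization_unit jL Sy.
  have [h eh] : divides d%:P (c%:P * (q y).1).
    apply/divides_polyC => n; rewrite coefCM.
    have [nf|nf] := ltnP n (size (q y).1); last first.
      by rewrite nth_default // mulr0; exact: divides0.
    by apply: dJ; apply/flatten_mapP; exists y => //; exact: mem_nth.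
  exists (j h / j (q y).2); apply: (mulIr tU).
  by rewrite [RHS]mulrAC divrK // -mulrA ey -!rmorphM eh.
have [h [t [St eh]]] := localization_frac jL r.
apply: (divides_v_set d0 (Sv _ St)); exists (h * w).
apply: (localization_inj jL); rewrite !rmorphM -eh -eg.
have -> : j t * (j c%:P * (u * j w)) = j t * (j c%:P * u) * j w by ring.
by rewrite er; ring.
Qed.

(** A nonzero constant a and an f in N_v generate an ideal of R with v-closure
    R: if u * a and u * f are in R, then a divides a numerator of u * a * f, so
    by McCoy's theorem it divides a numerator of u * a, and u is in R. *)
Lemma t_closed_avoids_v_set (D R : idomainType) (j : {rmorphism {poly D} -> R})
    (S : set {poly D}) (P' : set R) (a : D) (f : {poly D}) :
  is_localization j S -> S `<=` @v_set D -> is_prime_ideal P' ->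
  t_closed P' -> a != 0 -> P' (j a%:P) -> P' (j f) -> ~ v_set f.
Proof.
move=> jL Sv PP' tP' a0 P'a P'f fv; apply: (prime_ideal1 PP').
apply: (tP' [:: j a%:P; j f]) => [y|c d d0 ds].
  by rewrite !inE => /orP[]/eqP->.
have [r er] : divides d (c * j a%:P) by apply: ds; rewrite !inE eqxx.
have [r' er'] : divides d (c * j f) by apply: ds; rewrite !inE eqxx orbT.
have [g [t [St eg]]] := localization_frac jL r.
have [h [w [Sw eh]]] := localization_frac jL r'.
have ja0 : j a%:P != 0.
  by rewrite -(rmorph0 j) (inj_eq (localization_inj jL)) polyC_eq0.
have rf : r * j f = r' * j a%:P.
  apply: (mulIf d0).
  have -> : r * j f * d = r * d * j f by ring.
  by rewrite -er mulrAC er' mulrAC.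
have [g1 eg1] : divides a%:P g.
  apply: (divides_v_set a0 fv); apply: (divides_v_set a0 (Sv _ Sw)).
  exists (h * t); apply: (localization_inj jL); rewrite !rmorphM -eg -eh.
  have -> : j w * (j f * (r * j t)) = r * j f * (j w * j t) by ring.
  by rewrite rf; ring.
have tU := localization_unit jL St.
exists (j g1 / j t); rewrite mulr1; apply: (mulIf ja0); rewrite er.
apply: (mulIr tU); rewrite mulrAC eg eg1 rmorphM.
have -> : j g1 / j t * d * j a%:P * j t = j g1 / j t * j t * (d * j a%:P) by ring.
by rewrite divrK //; ring.
Qed.

(** The coefficients of the elements of Q form an ideal, and finitely many of
    them are among the coefficients of a single element of Q, obtained by
    shifting polynomials side by side. As Q avoids N_v, this ideal is t-proper,
    so that a prime t-ideal contains it. *)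
Lemma coefficients_in_prime_t (D : idomainType) (Q : set {poly D}) (a : D) :
  is_prime_ideal Q -> (forall f, Q f -> ~ v_set f) -> a != 0 -> Q a%:P ->
  exists M : set D, [/\ is_prime_ideal M, t_closed M, M a & Q `<=` coef_set M].
Proof.
move=> QP Qv a0 Qa.
pose I := [set x | exists f i, Q f /\ x = f`_i].
have merge f g n : Q f -> Q g -> Q (f + 'X^n * g).
  by move=> Qf Qg; apply: (prime_idealD QP) => //; apply: (prime_idealMl QP).
have iI : is_ideal I.
  split=> [|_ _ [f [i [Qf ->]]] [g [n [Qg ->]]]|c _ [f [i [Qf ->]]]].
  - by exists 0, 0; rewrite coef0; split=> //; exact: (prime_ideal0 QP).
  (* the shifts move f_i and g_n to the common index i + n *)
  - exists ('X^n * f + 'X^i * g), (i + n)%N; split.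
      by apply: (prime_idealD QP); apply: (prime_idealMl QP).
    by rewrite coefD !coefXnM ltnNge leq_addl ltnNge leq_addr /= addnK addKn.
  - by exists (c%:P * f), i; rewrite coefCM; split=> //; exact: (prime_idealMl QP).
have join (s : seq D) : (forall y, y \in s -> I y) ->
    exists f, [/\ Q f, f != 0 & forall y, y \in s -> exists i, y = f`_i].
  elim: s => [_|y s IHs ys]; first by exists a%:P; rewrite polyC_eq0.
  have [|f [Qf f0 sf]] := IHs; first by move=> z zs; apply: ys; rewrite inE zs orbT.
  have [g [n [Qg ->]]] := ys y (mem_head _ _).
  have low i : (i < size f)%N -> (f + 'X^(size f) * g)`_i = f`_i.
    by move=> fi; rewrite coefD coefXnM fi addr0.
  have high i : (f + 'X^(size f) * g)`_(size f + i) = g`_i.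
    by rewrite coefD coefXnM ltnNge leq_addr addKn nth_default ?add0r ?leq_addr.
  exists (f + 'X^(size f) * g); split; first exact: merge.
    have fs : (0 < size f)%N by rewrite size_poly_gt0.
    apply: contra_neq f0 => e; apply/eqP; rewrite -lead_coef_eq0.
    by rewrite lead_coefE -low ?prednK // e coef0.
  move=> z; rewrite inE => /predU1P[->|/sf[i ->]]; first by exists (size f + n)%N.
  have [fi|fi] := ltnP i (size f); first by exists i; rewrite low.
  by exists (size f + size g)%N; rewrite high !nth_default.
have tI : t_proper I.
  move=> s /join[f [Qf f0 sf]] s1; apply: (Qv _ Qf); split=> //.
  by apply: v_span_trans s1 => y /sf[i ->]; exact: v_span_coef.
have [M [PM IM tM]] := exists_prime_t_closed iI tI.
exists M; split=> // [|f Qf i]; apply: IM; last by exists f, i.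
by exists a%:P, 0; rewrite coefC.
Qed.

(** * Transfer of the property *)

Section TransferOfProperty.
Variable X : idomainType -> Prop.
Hypothesis X_iso : iso_invariant X.
Hypothesis X_stable : quotient_stable X.
Hypothesis X_DVR : forall V : idomainType, is_DVR V -> X V.
Hypothesis X_nagata : forall E : idomainType, X E <-> X (nagata E).
Variable D : idomainType.

(** The hypothesis on Q says that Q lies over zero or avoids N_v. In the second
    case Q is contained in M[X] for a prime t-ideal M of D, so R is a
    localization of the Nagata ring of D_M. *)
Lemma property_at_prime (Q : set {poly D}) (R : idomainType)
    (k : {rmorphism {poly D} -> R}) :
  t_locally X D -> is_prime_ideal Q -> is_localization k (~` Q) ->
  (forall a f, a != 0 -> Q a%:P -> Q f -> ~ v_set f) -> X R.
Proof.
move=> XD QP kL Qv.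
have [[a [a0 Qa]]|Q0] := pselect (exists a, a != 0 /\ Q a%:P); last first.
  apply: (property_upper_to_zero X_iso X_stable X_DVR QP _ kL) => a Qa.
  by apply: contrapT => /eqP a0; apply: Q0; exists a.
have [M [PM tM Ma QM]] :=
  coefficients_in_prime_t QP (fun f => Qv a f a0 Qa) a0 Qa.
have [P PE] := is_prime_prime_idealr PM.
have EM : [set x | x \in P] = M.
  by apply/seteqP; split=> x /=; rewrite PE => /asboolP.
have [j jL] := nagata_localization P; rewrite EM in jL.
apply: (property_localization X_iso X_stable jL kL); first exact: subsetC.
apply/(iffLR (X_nagata _))/XD/prime_t_idealP; rewrite EM; split=> //.
by exists a => //; rewrite PE; apply/asboolP.
Qed.

Variables (R : idomainType) (S : set {poly D}) (j : {rmorphism {poly D} -> R}).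
Hypotheses (jL : is_localization j S) (Sv : S `<=` @v_set D).

Lemma t_locally_ascent : t_locally X D -> t_locally X R.
Proof.
move=> XD P /prime_t_idealP[_ tP].
have PP := prime_idealr_is_prime P.
apply: (property_at_prime XD (prime_ideal_contract j PP)).
  exact: localization_comp jL PP (loc_map_prime P).
move=> a f a0 Pa Pf; exact: t_closed_avoids_v_set jL Sv PP tP a0 Pa Pf.
Qed.

Lemma t_locally_descent : t_locally X R -> t_locally X D.
Proof.
move=> XR P /prime_t_idealP[[a Pa a0] tP].
have PP := prime_idealr_is_prime P; have PQ := coef_set_prime PP.
have [|P' PP' P'P] := prime_ideal_extend jL PQ.
  by move=> f /Sv[_ f1] Pf; apply: (prime_ideal1 PP); apply: tP f1 => _ /(nthP 0)[i _ <-].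
have [Q QE] := is_prime_prime_idealr PP'.
have EQ : [set x | x \in Q] = P'.
  by apply/seteqP; split=> x /=; rewrite QE => /asboolP.
have [k kL] := nagata_localization P.
have kjL := localization_comp jL (prime_idealr_is_prime Q) (loc_map_prime Q).
rewrite EQ P'P in kjL.
apply: (iffRL (X_nagata _)); apply: (property_localization X_iso X_stable kjL kL) => //.
apply: XR; apply/prime_t_idealP; rewrite EQ; split.
  exists (j a%:P).
    rewrite QE; apply/asboolP; suff : coef_set [set x | x \in P] a%:P.
      by rewrite -P'P.
    by move=> i; rewrite coefC; case: eqP => // _; exact: idealr0.
  by rewrite -(rmorph0 j) (inj_eq (localization_inj jL)) polyC_eq0.
exact: extended_t_closed jL Sv tP PP' P'P.
Qed.

End TransferOfProperty.

Theorem theorem2p12 (D : idomainType) (X : idomainType -> Prop)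
  (X_iso : iso_invariant X)
  (X_stable : quotient_stable X)
  (X_DVR : forall V : idomainType, is_DVR V -> X V)
  (X_nagata : forall E : idomainType, X E <-> X (nagata E)) :
  [<-> t_locally X D;
       t_locally X {poly D};
       t_locally X (loc (A_ms D));
       t_locally X (loc (U_ms D));
       t_locally X (loc (N_ms D));
       t_locally X (loc (Nv_ms D));
       locally X (loc (Nv_ms D))].
Proof.
have up (R : idomainType) S (j : {rmorphism {poly D} -> R}) jL Sv :=
  @t_locally_ascent X X_iso X_stable X_DVR X_nagata D R S j jL Sv.
have down (R : idomainType) S (j : {rmorphism {poly D} -> R}) jL Sv :=
  @t_locally_descent X X_iso X_stable X_nagata D R S j jL Sv.
have locL := @loc_map_localization {poly D}.
have idL := idfun_localization {poly D}.
have idv : [set (1 : {poly D})] `<=` @v_set D.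
  by move=> _ ->; apply: (@v_set_coef1 _ _ 0); rewrite coef1.
have Nvv : ms_set (Nv_ms D) `<=` @v_set D by rewrite /= Nv_setE.
tfae.
- exact: up idL idv.
- by move/(down _ _ _ idL idv); exact: up (locL (A_ms D)) (@A_set_v_set D).
- move/(down _ _ _ (locL (A_ms D)) (@A_set_v_set D)).
  exact: up (locL (U_ms D)) (@U_set_v_set D).
- move/(down _ _ _ (locL (U_ms D)) (@U_set_v_set D)).
  exact: up (locL (N_ms D)) (@N_set_v_set D).
- move/(down _ _ _ (locL (N_ms D)) (@N_set_v_set D)).
  exact: up (locL (Nv_ms D)) Nvv.
- move/(down _ _ _ (locL (Nv_ms D)) Nvv) => XD P.
  have PP := prime_idealr_is_prime P; have NL := locL (Nv_ms D).
  apply: (property_at_prime X_iso X_stable X_DVR X_nagata XD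
    (prime_ideal_contract (loc_map (Nv_ms D)) PP)).
    exact: localization_comp NL PP (loc_map_prime P).
  move=> a f _ _ Pf fv; apply: (unit_notin_prime PP _ Pf).
  by apply: (localization_unit NL); rewrite /= Nv_setE.
- move=> XN; apply: (down _ _ _ (locL (Nv_ms D)) Nvv) => P _; exact: XN.
Qed.
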